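(* Let $d\ge 1$ and let $P$ be a $d$-dimensional convex polytope in $\mathbb{R}^d$, with graph $G(P)$. Then $G(P)$ is $d$-connected. Moreover, if $d\ge 3$ and $X$ is a separator of $G(P)$ with exactly $d$ vertices, then for every $x\in X$: every vertex of $X\setminus\{x\}$ lies in the link $\mathrm{lk}(x)$ of $x$ in $P$, and the set $X\setminus\{x\}$ is a separator of the graph of $\mathrm{lk}(x)$.
   Context: A $d$-polytope is the convex hull of a finite set of points in $\mathbb{R}^d$ having dimension $d$. A face of $P$ is $P$ itself or the intersection of $P$ with a hyperplane such that $P$ lies in one of its closed halfspaces; faces of dimension $0$, $1$, $d-1$ are vertices, edges, facets. The graph $G(P)$ has as vertices the vertices of $P$ and as edges the edges of $P$. A graph with at least $d+1$ vertices is $d$-connected if removing any $d-1$ vertices leaves a connected graph. A set $X$ of vertices of a graph $G$ separates two vertices $u,v\notin X$ if every $u$–$v$ path in $G$ contains a vertex of $X$; $X$ is a separator of $G$ if it separates some two vertices of $G$. The link $\mathrm{lk}(x)$ of a vertex $x$ of $P$ is the set of faces of $P$ that do not contain $x$ but lie in some facet of $P$ containing $x$; its graph is the graph whose vertices are the vertices (0-dimensional faces) in $\mathrm{lk}(x)$ and whose edges are the edges (1-dimensional faces) in $\mathrm{lk}(x)$. *)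

(* Defs.v *)
From HB Require Import structures.
From mathcomp Require Import all_boot all_order all_algebra.
From mathcomp Require Import reals.
Set Implicit Arguments. Unset Strict Implicit. Unset Printing Implicit Defensive.
Import Order.TTheory GRing.Theory Num.Theory.
Local Open Scope ring_scope.

Section Polytopes.
Variables (R : realType) (d : nat).
Notation pt := 'rV[R]_d.

Definition dot (a x : pt) : R := \sum_(i < d) a 0 i * x 0 i.

Definition conv (V : seq pt) : pt -> Prop := fun x =>
  exists w : 'I_(size V) -> R,
    (forall i, 0 <= w i) /\ \sum_(i < size V) w i = 1 /\
    x = \sum_(i < size V) w i *: V`_i.

Definition affine_indep (k : nat) (p : 'I_k.+1 -> pt) : bool :=
  row_free (\matrix_(i < k) (p (lift ord0 i) - p ord0)).

Definition has_dim (S : pt -> Prop) (k : nat) : Prop :=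
  (exists p : 'I_k.+1 -> pt, (forall i, S (p i)) /\ affine_indep p) /\
  ~ (exists p : 'I_k.+2 -> pt, (forall i, S (p i)) /\ affine_indep p).

Definition is_face (P F : pt -> Prop) : Prop :=
  (forall x, F x <-> P x) \/
  exists (a : pt) (b : R), a != 0 /\ (forall x, P x -> dot a x <= b) /\
    (forall x, F x <-> (P x /\ dot a x = b)).

Definition pvertex (P : pt -> Prop) (v : pt) : Prop :=
  exists F, is_face P F /\ has_dim F 0 /\ F v.

Definition pedge (P : pt -> Prop) (u v : pt) : Prop :=
  pvertex P u /\ pvertex P v /\ u != v /\
  exists F, is_face P F /\ has_dim F 1 /\ F u /\ F v.

Definition is_facet (P F : pt -> Prop) : Prop := is_face P F /\ has_dim F d.-1.

(* the link of x: faces not containing x but contained in a facet containing x.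
   Vertices of lk(x) = vertices of P in lk(x); edges = edges of P in lk(x). *)
Definition lk_vertex (P : pt -> Prop) (x v : pt) : Prop :=
  exists F, is_face P F /\ has_dim F 0 /\ F v /\ ~ F x /\
    exists G, is_facet P G /\ G x /\ (forall y, F y -> G y).

Definition lk_edge (P : pt -> Prop) (x u v : pt) : Prop :=
  lk_vertex P x u /\ lk_vertex P x v /\ u != v /\
  exists F, is_face P F /\ has_dim F 1 /\ F u /\ F v /\ ~ F x /\
    exists G, is_facet P G /\ G x /\ (forall y, F y -> G y).

End Polytopes.

Section Graphs.
Variable T : eqType.
Variables (Vx : T -> Prop) (E : T -> T -> Prop).

Fixpoint is_walk (x : T) (s : seq T) : Prop :=
  match s with
  | [::] => True
  | y :: s' => E x y /\ is_walk y s'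
  end.

Definition is_path (u v : T) (s : seq T) : Prop :=
  uniq (u :: s) /\ (forall z, z \in u :: s -> Vx z) /\ is_walk u s /\ last u s = v.

Definition gconnected : Prop :=
  forall u v, Vx u -> Vx v -> exists s, is_path u v s.

Definition separates (X : seq T) (u v : T) : Prop :=
  Vx u /\ Vx v /\ u \notin X /\ v \notin X /\
  forall s, is_path u v s -> exists2 z, z \in u :: s & z \in X.

Definition is_separator (X : seq T) : Prop :=
  (forall z, z \in X -> Vx z) /\ exists u v, separates X u v.

End Graphs.

Definition k_connected (T : eqType) (Vx : T -> Prop) (E : T -> T -> Prop)
    (k : nat) : Prop :=
  (exists s : seq T, uniq s /\ size s = k.+1 /\ forall z, z \in s -> Vx z) /\
  forall Y : seq T, uniq Y -> size Y = k.-1 -> (forall z, z \in Y -> Vx z) ->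
    gconnected (fun z => Vx z /\ z \notin Y) E.

(* Main.v *)
Require Import Defs.
From HB Require Import structures.
From mathcomp Require Import all_boot all_order all_algebra.
From mathcomp Require Import boolp reals ring lra zify.
Set Implicit Arguments. Unset Strict Implicit. Unset Printing Implicit Defensive.
Import Order.TTheory GRing.Theory Num.Theory.
Local Open Scope ring_scope.

(** Everything is reduced to one statement about a pointed cone spanned by finitely
    many vectors [w i]: if a linear functional [f] vanishes on an extreme ray [u] and
    is not identically zero, then after choosing the sign of [f] any other extreme
    ray [v] has [0 <= f v], and simplex-type ascents from [u] and [v] reach the same
    maximal ray; they stay in [0 < f] after the start. Choosing [f] to vanish also on
    a prescribed set [Y] gives paths avoiding [Y].

    Applied to the cone over [{1} x P] this is Balinski's theorem. For the link of a
    vertex [x], push [x] slightly out of [P], to a point [o] beyond exactly the facets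
    through [x], and take the cone with apex [o] spanned by [P]: its extreme rays and
    two-dimensional faces come from vertices and edges of the link, because a face of
    [P] cut out by a hyperplane through [o] lies in a facet having [o] on its outer
    side. Hence neighbours of [x] stay connected in the link after deleting [d - 2]
    vertices.

    If [X] is a separator with [d] vertices and [x] is in [X], some path avoiding
    [X \ x] joins the two sides through [x], so neighbours of [x] on both sides are
    separated by [X \ x] inside the link; this needs [d - 1] vertices of the link. *)

(** * Functionals that separate or annihilate given vectors *)

Section LinearAlgebra.
Variable R : fieldType.

Lemma mx_col_neq0 m n (A : 'M[R]_(m, n)) : A != 0 -> exists j, col j A != 0.
Proof.
move=> A0; apply: contrapT => H; case/negP: A0; apply/eqP/matrixP => i j.
have /eqP/matrixP/(_ i 0) : col j A == 0.
  by apply: contrapT => /negP Hj; apply: H; exists j.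
by rewrite !mxE.
Qed.

Lemma exists_separating_functional m n (A : 'M[R]_(m, n)) (u : 'rV_n) :
  ~~ (u <= A)%MS -> exists e : 'cV_n, A *m e = 0 /\ (u *m e) 0 0 != 0.
Proof.
rewrite submxE => /mx_col_neq0 [j].
rewrite !colE -mulmxA -colE => Hj; exists (col j (cokermx A)); split.
  by rewrite colE mulmxA mulmx_coker mul0mx.
apply: contra Hj => /eqP H; apply/eqP/matrixP => a b.
by rewrite !ord1 H mxE.
Qed.

Lemma exists_annihilator n (s : seq 'rV[R]_n) : (size s < n)%N ->
  exists f : 'cV_n, f != 0 /\ forall y, y \in s -> y *m f = 0.
Proof.
move=> lt_s; pose A := \matrix_(i < size s) s`_i.
have : cokermx A != 0.
  by rewrite -mxrank_eq0 mxrank_coker -lt0n subn_gt0 (leq_ltn_trans (rank_leq_row _)).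
move=> /mx_col_neq0 [j Hj]; exists (col j (cokermx A)); split=> // y ys.
have lt_y : (index y s < size s)%N by rewrite index_mem.
have -> : y = row (Ordinal lt_y) A.
  by rewrite rowK /= nth_index.
by rewrite -row_mul colE mulmxA mulmx_coker mul0mx linear0.
Qed.

End LinearAlgebra.

(** * Minima and uniform bounds over finite index sets *)

Section FiniteMinima.
Variables (R : realFieldType) (I : finType).

(** The ratio test of the simplex method. In cross-multiplied form it exhibits a combination of [a]
    and [b] that is nonnegative on [P] and zero at [j], which is how faces are tilted below. *)
Lemma exists_min_ratio (P : pred I) (a b : I -> R) :
  (exists i, P i) -> (forall i, P i -> 0 < b i) ->
  exists j, P j /\ forall i, P i -> a j * b i <= a i * b j.
Proof.
move=> [i0 Pi0] b0.
have [j Pj Hj] := arg_minP (fun i => a i / b i) Pi0.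
exists j; split=> // i Pi; have := Hj i Pi.
by rewrite ler_pdivrMr ?b0 // mulrAC ler_pdivlMr ?b0.
Qed.

Lemma exists_large_multiple (a b : I -> R) :
  (forall i, 0 <= a i) -> (forall i, a i = 0 -> 0 <= b i) ->
  exists N, 0 < N /\ forall i, 0 <= N * a i + b i /\
    (N * a i + b i = 0 <-> a i = 0 /\ b i = 0).
Proof.
(* Division by zero gives zero, so indices with [a i = 0] add nothing to the sum; the summand 1
   makes the inequality strict at the others. *)
move=> a0 b0; pose N := 1 + \sum_i `|b i| / a i.
have term_ge0 i : 0 <= `|b i| / a i by rewrite divr_ge0.
have N1 : 1 <= N by rewrite lerDl sumr_ge0.
exists N; split=> [|i]; first lra.
have [ai0|ai_neq0] := eqVneq (a i) 0.
  rewrite ai0 mulr0 add0r; split; first exact: b0.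
  by split=> [->|[]].
have ai : 0 < a i by rewrite lt_neqAle eq_sym ai_neq0 a0.
have : 1 + `|b i| / a i <= N.
  by rewrite lerD2l (bigD1 i) //= lerDl sumr_ge0.
rewrite -(ler_pM2r ai) mulrDl mul1r divfK // => HN.
have := ler_norm (- b i); rewrite normrN => Hb.
have pos : 0 < N * a i + b i by lra.
split; first exact: ltW.
by split=> [E|[E _]]; [rewrite E ltxx in pos | rewrite E ltxx in ai].
Qed.

Lemma exists_uniform_eps (Q : I -> R -> Prop) :
  (forall i, exists2 e, 0 < e & forall t, 0 < t -> t <= e -> Q i t) ->
  exists2 t, 0 < t & forall i, Q i t.
Proof.
move=> H.
have {}H i : exists e, 0 < e /\ forall t, 0 < t -> t <= e -> Q i t.
  by have [e] := H i; exists e.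
have [e He] := choice H.
have [i0|noI] := pselect (exists i : I, true); last first.
  by exists 1 => // i; case: noI; exists i.
have [j [_ Hj]] := @exists_min_ratio predT e (fun=> 1) i0 (fun _ _ => ltr01).
exists (e j) => [|i]; first by case: (He j).
by have [_] := He i; apply; [case: (He j) | have := Hj i isT; rewrite !mulr1].
Qed.

End FiniteMinima.

(** * Cones spanned by finitely many vectors, and their faces *)

Section Cones.
Variables (R : realFieldType) (n : nat) (I : finType) (w : I -> 'rV[R]_n).

Definition ev (f : 'cV[R]_n) (i : I) : R := (w i *m f) 0 0.

Lemma evD f e i : ev (f + e) i = ev f i + ev e i.
Proof. by rewrite /ev mulmxDr mxE. Qed.

Lemma evN f i : ev (- f) i = - ev f i.
Proof. by rewrite /ev mulmxN mxE. Qed.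

Lemma evZ c f i : ev (c *: f) i = c * ev f i.
Proof. by rewrite /ev -scalemxAr mxE. Qed.

Definition evE := (evD, evN, evZ).

Definition nonneg f := forall i, 0 <= ev f i.

Definition parallel p i := (w i <= w p)%MS.

(** An extreme ray, exposed by [h]. Several generators may span the same ray, hence [parallel]
    instead of equality of indices. *)
Definition ray p :=
  exists h, [/\ nonneg h, ev h p = 0 & forall i, ev h i = 0 -> parallel p i].

(** The functional [k] exposes a two-dimensional face, whose two extreme rays are those of [p] and
    [q]. *)
Definition cone_edge p q := [/\ ray p, ray q, ~~ parallel p q &
  exists k, [/\ nonneg k, ev k p = 0, ev k q = 0 &
    forall i, ev k i = 0 -> (w i <= w p + w q)%MS]].

Lemma ev_parallel f p i : parallel p i -> ev f p = 0 -> ev f i = 0.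
Proof.
by move=> /sub_rVP [c wi] fp; rewrite /ev wi -scalemxAl mxE [X in c * X]fp mulr0.
Qed.

(** A face of a face is a face: a large multiple of [k] outweighs the negative values that [e] may
    take off the face of [k]. *)
Lemma face_of_face k e : nonneg k -> (forall i, ev k i = 0 -> 0 <= ev e i) ->
  exists2 k', nonneg k' & forall i, ev k' i = 0 <-> ev k i = 0 /\ ev e i = 0.
Proof.
move=> k0 e0; have [N [_ HN]] := exists_large_multiple k0 e0.
by exists (N *: k + e) => i; rewrite !evE; case: (HN i).
Qed.

(** * Pointed cones: extreme rays, edges and simplex steps *)

Section Pointed.
Variable g : 'cV[R]_n.
Hypothesis g_gt0 : forall i, 0 < ev g i.

Lemma parallel_sym p q : parallel p q -> parallel q p.
Proof.
move=> /sub_rVP [c wq]; apply/sub_rVP; exists c^-1.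
rewrite wq scalerA mulVf ?scale1r //; apply: contraTneq (g_gt0 q) => c0.
by rewrite /ev wq c0 scale0r mul0mx mxE ltxx.
Qed.

(** Induction on the number of generators in the face: while two of them are not parallel,
    minimising a functional [e] that separates them, relative to [g], cuts out a smaller nonempty
    face. *)
Lemma ray_in_face k : nonneg k -> (exists i, ev k i = 0) ->
  exists2 p, ray p & ev k p = 0.
Proof.
have [m] := ubnP #|[set i | ev k i == 0]|.
elim: m k => // m IH k lt_m k0 [p kp].
have [H|] := pselect (forall i, ev k i = 0 -> parallel p i).
  by exists p => //; exists k.
move/existsNP => [q /not_implyP [kq /negP npq]].
have [e [ep eq0]] := exists_separating_functional npq.
have {}ep : ev e p = 0 by rewrite /ev ep mxE.
have [||j [/eqP kj Hj]] := @exists_min_ratio _ _ (fun i => ev k i == 0) (ev e) (ev g).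
- by exists p; apply/eqP.
- by move=> i _.
have [|k' k'0 k'Z] := @face_of_face k (ev g j *: e - ev e j *: g) k0.
  move=> i /eqP/Hj; rewrite !evE; lra.
have [||r rr] := IH k' _ k'0; last by move=> /k'Z [kr _]; exists r.
  rewrite -ltnS (leq_trans _ lt_m) // ltnS; apply: proper_card.
  rewrite properE; apply/andP; split.
    by apply/subsetP => i; rewrite !inE => /eqP/k'Z [-> _].
  apply/subsetPn.
  (* The new face is proper: if the minimal ratio is zero it loses [q], where [e] is nonzero;
     otherwise it loses [p], where [e] vanishes. *)
  have [ej|ej] := eqVneq (ev e j) 0; [exists q | exists p]; rewrite !inE ?kq ?kp //;
    apply/eqP => /k'Z [_]; rewrite !evE ?ej ?ep ?mulr0 ?mul0r ?oppr0 ?mul0r ?addr0 ?add0r.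
    by move=> /eqP; rewrite mulf_eq0 (negbTE eq0) gt_eqF.
  by move=> /eqP; rewrite oppr_eq0 mulf_eq0 (negbTE ej) gt_eqF.
by exists j; apply/k'Z; split=> //; rewrite !evE; ring.
Qed.

(** Induction on the number of generators in the face. The generator [j] of least [g / h] spans the
    second extreme ray if the face is two-dimensional. Otherwise the face is replaced by a smaller
    one that keeps [p] and some generator not parallel to it. *)
Lemma edge_in_face p k : ray p -> nonneg k -> ev k p = 0 ->
  (exists2 q, ev k q = 0 & ~~ parallel p q) ->
  exists2 q, cone_edge p q & ev k q = 0.
Proof.
move=> rp; have [h [h0 hp hZ]] := rp.
have h_gt0 i : ~~ parallel p i -> 0 < ev h i.
  move=> npi; rewrite lt_neqAle h0 andbT eq_sym.
  by apply: contraNneq npi => /hZ.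
have [m] := ubnP #|[set i | ev k i == 0]|.
elim: m k => // m IH k lt_m k0 kp [q0 kq0 npq0].
have [||j [/andP[/eqP kj npj] Hj]] := @exists_min_ratio _ _
  (fun i => (ev k i == 0) && ~~ parallel p i) (ev g) (ev h).
- by exists q0; rewrite kq0 eqxx.
- by move=> i /andP[_ /h_gt0].
have hj := h_gt0 _ npj.
have [span|] := pselect (forall i, ev k i = 0 -> (w i <= w p + w j)%MS).
  exists j => //.
  (* On [w i = a w p + b w j] this functional takes the value [a] times [ev h j * ev g p], so its
     zeros in the plane have [a = 0]. *)
  have [|l l0 lZ] := @face_of_face k (ev h j *: g - ev g j *: h) k0.
    move=> i ki; rewrite !evE; have [pi|npi] := boolP (parallel p i).
      by rewrite (ev_parallel pi hp) mulr0 oppr0 addr0 mulr_ge0 // ltW.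
    have := Hj i; rewrite ki eqxx npi => /(_ isT); lra.
  split=> //; last by exists k; split.
  exists l; split=> // [|i].
    by apply/lZ; split=> //; rewrite !evE; ring.
  move=> /lZ [/span /sub_addsmxP [[a b] /= wi]].
  rewrite (mx11_scalar a) (mx11_scalar b) !mul_scalar_mx in wi.
  have evi f : ev f i = a 0 0 * ev f p + b 0 0 * ev f j.
    by rewrite /ev wi mulmxDl -!scalemxAl !mxE.
  rewrite !evE !evi hp => E.
  have {}E : a 0 0 * (ev h j * ev g p) = 0 by lra.
  move/eqP: E; rewrite mulf_eq0 orbC gt_eqF ?mulr_gt0 //= => /eqP a0.
  by rewrite /parallel wi a0 scale0r add0r scalemx_sub.
move/existsNP => [r /not_implyP [kr /negP nr]].
have [e [epj er]] := exists_separating_functional nr.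
have e_span i : (w i <= w p + w j)%MS -> ev e i = 0.
  by move=> /submxP [D wi]; rewrite /ev wi -mulmxA epj mulmx0 mxE.
have e_p : ev e p = 0 by rewrite e_span ?addsmxSl.
have e_j : ev e j = 0 by rewrite e_span ?addsmxSr.
wlog er_gt0 : e {epj e_span} e_p e_j er / 0 < ev e r.
  move=> W; move: er; rewrite neq_lt => /orP[er|er].
    by apply: (W (- e)); rewrite ?evE ?e_p ?e_j ?oppr0 ?oppr_gt0 // mulmxN mxE oppr_eq0 lt_eqF.
  by apply: (W e) => //; rewrite gt_eqF.
have [||s [/andP[/eqP ks es] Hs]] := @exists_min_ratio _ _
  (fun i => (ev k i == 0) && (0 < ev e i)) (ev h) (ev e).
- by exists r; rewrite kr eqxx er_gt0.
- by move=> i /andP[].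
(* Tilting [h] by the functional [e], which vanishes at [p] and [j]: the new face contains [p] and
   [s] but not [j], where [h] is positive. *)
have [|k' k'0 k'Z] := @face_of_face k (ev e s *: h - ev h s *: e) k0.
  move=> i ki; rewrite !evE; have [ei|ei] := ltP 0 (ev e i).
    by have := Hs i; rewrite ki eqxx ei => /(_ isT); lra.
  have : 0 <= ev e s * ev h i by rewrite mulr_ge0 // ltW.
  have : 0 <= ev h s * - ev e i by rewrite mulr_ge0 // oppr_ge0.
  by lra.
have [|||q pq] := IH k' _ k'0; last by move=> /k'Z [kq _]; exists q.
- rewrite -ltnS (leq_trans _ lt_m) // ltnS; apply: proper_card.
  rewrite properE; apply/andP; split.
    by apply/subsetP => i; rewrite !inE => /eqP/k'Z [-> _].
  apply/subsetPn; exists j; rewrite !inE ?kj //.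
  apply/eqP => /k'Z [_]; rewrite !evE e_j mulr0 oppr0 addr0 => /eqP.
  by rewrite gt_eqF // mulr_gt0.
- by apply/k'Z; split=> //; rewrite !evE hp e_p; ring.
exists s; first by apply/k'Z; split=> //; rewrite !evE; ring.
by apply/negP => /ev_parallel /(_ e_p) E; rewrite E ltxx in es.
Qed.

(** Subtracting from [h] the largest multiple of [f] that leaves it nonnegative exposes a face
    through [p] on which [f] is a positive multiple of [h]. An edge from [p] in that face ends where
    [h], hence [f], is positive. *)
Lemma simplex_step0 p f : ray p -> ev f p = 0 -> (exists i, 0 < ev f i) ->
  exists2 q, cone_edge p q & 0 < ev f q.
Proof.
move=> rp fp fpos; have [h [h0 hp hZ]] := rp.
have [//|j [fj Hj]] := @exists_min_ratio _ _ (fun i => 0 < ev f i) (ev h) (ev f) fpos.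
have npj : ~~ parallel p j.
  by apply/negP => /ev_parallel /(_ fp) E; rewrite E ltxx in fj.
have [|||q pq] := @edge_in_face p (ev f j *: h - ev h j *: f) rp.
- move=> i; rewrite !evE; have [fi|fi] := ltP 0 (ev f i).
    by have := Hj i fi; lra.
  have : 0 <= ev f j * ev h i by rewrite mulr_ge0 // ltW.
  have : 0 <= ev h j * - ev f i by rewrite mulr_ge0 // oppr_ge0.
  by lra.
- by rewrite !evE hp fp; ring.
- by exists j => //; rewrite !evE; ring.
rewrite !evE => E; exists q => //; case: pq => _ _ npq _.
have hq : 0 < ev h q.
  by rewrite lt_neqAle h0 andbT eq_sym; apply: contraNneq npq => /hZ.
have : 0 < ev h j * ev f q by have := mulr_gt0 fj hq; lra.
by rewrite pmulr_rgt0 // lt_neqAle h0 andbT eq_sym; apply: contraNneq npj => /hZ.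
Qed.

(** Local optimality implies global optimality for the ratio [f / g]: the previous step is applied
    to the combination of [f] and [g] that vanishes at [p]. *)
Lemma simplex_step p f : ray p -> (exists i, ev f p * ev g i < ev f i * ev g p) ->
  exists2 q, cone_edge p q & ev f p * ev g q < ev f q * ev g p.
Proof.
move=> rp [i Hi].
have [||q pq] := @simplex_step0 p (ev g p *: f - ev f p *: g) rp.
- by rewrite !evE; ring.
- by exists i; rewrite !evE; lra.
by rewrite !evE => Hq; exists q => //; lra.
Qed.

(** The maximisers of [f / g] form a face, and this face contains an extreme ray. *)
Lemma exists_max_ray f : (exists i : I, true) ->
  exists2 m, ray m & forall i, ev f i * ev g m <= ev f m * ev g i.
Proof.
move=> I0.
have [//|//|j [_ Hj]] := @exists_min_ratio _ _ predT (fun i => - ev f i) (ev g).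
have [||m rm] := @ray_in_face (ev f j *: g - ev g j *: f).
- by move=> i; rewrite !evE; have := Hj i isT; lra.
- by exists j; rewrite !evE; ring.
rewrite !evE => fm; exists m => // i; rewrite -(ler_pM2r (g_gt0 j)).
have -> : ev f m * ev g i * ev g j = ev f j * ev g i * ev g m.
  have -> : ev f m * ev g i * ev g j = ev g j * ev f m * ev g i by ring.
  have -> : ev g j * ev f m = ev f j * ev g m by lra.
  by ring.
by rewrite mulrAC ler_pM2r //; have := Hj i isT; lra.
Qed.

(** * Connecting extreme rays by ascending paths *)

Section Connectivity.
(** Connectedness is kept abstract as [C], so that one argument serves both the graph of the
    polytope and that of the link; [ok] marks the generators that are not deleted. *)
Variables (ok : I -> Prop) (C : I -> I -> Prop).
Hypothesis Csym : forall a b, C a b -> C b a.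
Hypothesis Ctrans : forall a b c, C a b -> C b c -> C a c.
Hypothesis Cpar : forall a b, ok a -> ok b -> ray a -> ray b -> parallel a b -> C a b.
Hypothesis Cedge : forall a b, ok a -> ok b -> cone_edge a b -> C a b.

(* [phi = N f - h] has its maximum on the slice [g = 1] only on the ray [m], and
   [0 < phi] forces [0 < f]: a [phi]-ascending path never leaves [0 < f]. *)
Lemma ascend_to_max f m h N p :
  (forall i, 0 < ev f i -> ok i) -> 0 < N -> ray m -> 0 < ev f m ->
  (forall i, ev f i * ev g m <= ev f m * ev g i) ->
  nonneg h -> ev h m = 0 -> (forall i, ev h i = 0 -> parallel m i) ->
  ray p -> 0 < ev (N *: f - h) p -> C p m.
Proof.
move=> okf N0 rm fm mmax h0 hm hZ; set phi := N *: f - h.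
have phi_f i : 0 < ev phi i -> 0 < ev f i.
  move=> phi_i; rewrite -(pmulr_rgt0 _ N0); apply: lt_le_trans phi_i _.
  by rewrite /phi !evE lerBlDr lerDl.
pose ratio i := ev phi i / ev g i.
have [k] := ubnP #|[set i | ratio p < ratio i]|.
elim: k p => // k IH p lt_k rp phi_p.
have okp := okf _ (phi_f _ phi_p); have okm := okf _ fm.
have [mp|nmp] := boolP (parallel m p).
  by apply: Cpar => //; apply: parallel_sym.
have hp : 0 < ev h p.
  by rewrite lt_neqAle h0 andbT eq_sym; apply: contraNneq nmp => /hZ.
have [|q pq Hq] := @simplex_step p phi rp.
  exists m; rewrite /phi !evE hm.
  have := mulr_gt0 hp (g_gt0 m).
  have : 0 <= N * (ev f m * ev g p - ev f p * ev g m).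
    by rewrite mulr_ge0 ?subr_ge0 ?mmax // ltW.
  by lra.
have phi_q : 0 < ev phi q.
  by rewrite -(pmulr_lgt0 _ (g_gt0 p)); apply: lt_trans Hq; rewrite mulr_gt0.
have pq_ratio : ratio p < ratio q.
  by rewrite /ratio ltr_pdivrMr // mulrAC ltr_pdivlMr.
have rq : ray q by case: pq.
apply: Ctrans (Cedge okp (okf _ (phi_f _ phi_q)) pq) _.
apply: IH => //; rewrite -ltnS (leq_trans _ lt_k) // ltnS; apply: proper_card.
rewrite properE; apply/andP; split.
  by apply/subsetP => i; rewrite !inE; apply: lt_trans.
by apply/subsetPn; exists q; rewrite !inE ?ltxx.
Qed.

(** Both rays are joined to one ray [m] that maximises [f / g]. A ray with [f = 0] first makes one
    simplex step into [0 < f]. *)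
Lemma level_connected f u v : (forall i, 0 < ev f i -> ok i) ->
  (exists i, 0 < ev f i) -> ray u -> ray v -> ok u -> ok v ->
  0 <= ev f u -> 0 <= ev f v -> C u v.
Proof.
move=> okf fpos ru rv oku okv fu fv.
have [m rm mmax] := exists_max_ray f (ex_intro _ u isT).
have f_m : 0 < ev f m.
  have [i fi] := fpos; rewrite -(pmulr_lgt0 _ (g_gt0 i)).
  by apply: lt_le_trans (mmax i); rewrite mulr_gt0.
have [h [h0 hm hZ]] := rm.
suff reach p : ray p -> ok p -> 0 <= ev f p -> C p m.
  by apply: Ctrans (reach u ru oku fu) (Csym (reach v rv okv fv)).
have reach_pos q : ray q -> 0 < ev f q -> C q m.
  (* With this [N] the value of [N *: f - h] at [q] is exactly [ev f q], which is positive. *)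
  move=> rq fq; apply: (@ascend_to_max f m h (1 + ev h q / ev f q)) => //.
    by rewrite ltr_wpDr // divr_ge0 // ltW.
  by rewrite !evE mulrDl divfK ?gt_eqF // mul1r addrK.
move=> rp okp; rewrite le_eqVlt => /orP[/eqP fp|]; last exact: reach_pos.
have [q pq fq] := simplex_step0 rp (esym fp) fpos.
apply: Ctrans (Cedge okp (okf _ fq) pq) (reach_pos _ _ fq).
by case: pq.
Qed.

(** As [f] vanishes at [u], its sign is free: it is chosen so that [f] is nonnegative at [v], or,
    when [f] vanishes there too, so that [f] is positive somewhere. *)
Lemma connected_off_hyperplane f u v : (forall i, ev f i != 0 -> ok i) ->
  (exists i, ev f i != 0) -> ray u -> ray v -> ok u -> ok v ->
  ev f u = 0 -> C u v.
Proof.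
move=> okf [i fi] ru rv oku okv fu.
wlog [fv fpos] : f okf fi fu / 0 <= ev f v /\ exists i, 0 < ev f i => [W|].
  have WN : ev f v <= 0 -> (exists i, ev f i < 0) -> C u v.
    move=> fv [j fj]; apply: (W (- f)); rewrite ?evE ?oppr_eq0 ?fu ?oppr0 ?oppr_ge0 //.
      by move=> l; rewrite evE oppr_eq0; apply: okf.
    by split=> //; exists j; rewrite evE oppr_gt0.
  have WP : 0 <= ev f v -> (exists i, 0 < ev f i) -> C u v.
    by move=> fv [j fj]; apply: (W f) => //; split=> //; exists j.
  case: (ltrgtP (ev f v) 0) => E.
  - by apply: WN; [apply: ltW | exists v].
  - by apply: WP; [apply: ltW | exists v].
  - by move: fi; rewrite neq_lt => /orP[] Ei; [apply: WN | apply: WP]; rewrite ?E //; exists i.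
apply: (@level_connected f) => //; last by rewrite fu.
by move=> j fj; apply: okf; rewrite gt_eqF.
Qed.

End Connectivity.
End Pointed.

(** * Facets of a full-dimensional cone *)

Hypothesis spanning : forall f, (forall i, ev f i = 0) -> f = 0.

(** The last clause is codimension one in dual form: the zero generators of [phi] span a
    hyperplane. *)
Definition facet_functional phi := [/\ nonneg phi, phi != 0 &
  forall e, (forall i, ev phi i = 0 -> ev e i = 0) -> exists c, e = c *: phi].

(** Induction on the number of generators off the face. Unless [f] already defines a facet, it is
    tilted by some [e] that vanishes on the face until a further generator is absorbed, with signs
    arranged so that the value at [o] stays nonpositive. *)
Lemma facet_above f (o : 'rV_n) : nonneg f -> f != 0 -> (o *m f) 0 0 <= 0 ->
  exists phi, [/\ facet_functional phi, (o *m phi) 0 0 <= 0 &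
    forall i, ev f i = 0 -> ev phi i = 0].
Proof.
pose val (f : 'cV[R]_n) : R := (o *m f) 0 0.
have valD a b : val (a + b) = val a + val b by rewrite /val mulmxDr mxE.
have valN a : val (- a) = - val a by rewrite /val mulmxN mxE.
have valZ c a : val (c *: a) = c * val a by rewrite /val -scalemxAr mxE.
have [m] := ubnP #|[set i | ev f i != 0]|.
elim: m f => // m IH f lt_m f0 fn0; rewrite -/(val f) => fo.
have [H|] := pselect (forall e, (forall i, ev f i = 0 -> ev e i = 0) ->
  exists c, e = c *: f); first by exists f.
move/existsNP => [e1 /not_implyP [e1Z /forallNP e1f]].
have [i0 fi0] : exists i, 0 < ev f i.
  apply: contrapT => /forallNP H; case/eqP: fn0; apply: spanning => i.
  by apply/eqP; rewrite eq_le f0 andbT leNgt; apply/negP.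
(* If [f] vanishes at [o], a choice of sign for [e1] suffices. Otherwise a multiple of [f] is
   subtracted to make it vanish at [o], which leaves the sign free to achieve [ev e i0 <= 0]. *)
have [e [eZ ef eo e_or]] : exists e, [/\ forall i, ev f i = 0 -> ev e i = 0,
    forall c, e <> c *: f, val e <= 0 & val f = 0 \/ ev e i0 <= 0].
  have [vf|vf] := eqVneq (val f) 0.
    have [H|H] := leP (val e1) 0; first by exists e1; split=> //; left.
    exists (- e1); split; last by left.
    - by move=> i /e1Z; rewrite evE => ->; rewrite oppr0.
    - by move=> c /(congr1 -%R); rewrite opprK -scaleNr; apply: e1f.
    - by rewrite valN oppr_le0 ltW.
  pose e2 := e1 - (val e1 / val f) *: f.
  have e2Z i : ev f i = 0 -> ev e2 i = 0.
    by move=> Ef; rewrite !evE Ef e1Z // mulr0 oppr0 addr0.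
  have e2f c : e2 <> c *: f.
    by move=> /(canRL (subrK _)); rewrite -scalerDl; apply: e1f.
  have e2o : val e2 = 0 by rewrite valD valN valZ divfK // subrr.
  have [H|H] := leP (ev e2 i0) 0; first by exists e2; rewrite e2o; split=> //; right.
  exists (- e2); rewrite valN e2o oppr0; split=> //.
  - by move=> i /e2Z; rewrite evE => ->; rewrite oppr0.
  - by move=> c /(congr1 -%R); rewrite opprK -scaleNr; apply: e2f.
  - by right; rewrite evE oppr_le0 ltW.
have [|//|j [fj Hj]] := @exists_min_ratio _ _ (fun i => 0 < ev f i) (ev e) (ev f).
  by exists i0.
pose f' := ev f j *: e - ev e j *: f.
have f'Z i : ev f i = 0 -> ev f' i = 0.
  by move=> Ef; rewrite !evE Ef eZ // !mulr0 subr0.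
have f'0 : nonneg f'.
  move=> i; have := f0 i; rewrite le_eqVlt => /orP[/eqP/esym/f'Z ->//|fi].
  by rewrite !evE; have := Hj i fi; lra.
have f'n0 : f' != 0.
  apply/eqP => /(canRL (subrK _)); rewrite add0r => /(congr1 (fun x => (ev f j)^-1 *: x)).
  by rewrite !scalerA mulVf ?gt_eqF // scale1r; apply: ef.
have f'o : val f' <= 0.
  rewrite /f' valD valN !valZ.
  have H1 : ev f j * val e <= 0 by rewrite pmulr_rle0.
  case: e_or => [->|H]; first by rewrite mulr0 subr0.
  (* The least ratio [e / f], attained at [j], is at most the ratio at [i0]. *)
  have H2 : ev e j <= 0.
    rewrite -(pmulr_lle0 _ fi0); apply: le_trans (Hj _ fi0) _.
    by rewrite pmulr_lle0.
  have : 0 <= (- ev e j) * (- val f) by rewrite mulr_ge0 // oppr_ge0.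
  have : 0 <= ev e j * val f by rewrite mulr_le0.
  by lra.
have [|//|//|phi [Hphi phio phiZ]] := IH f' _ f'0.
  rewrite -ltnS (leq_trans _ lt_m) // ltnS; apply: proper_card.
  rewrite properE; apply/andP; split.
    by apply/subsetP => i; rewrite !inE; apply: contraNN => /eqP/f'Z ->.
  apply/subsetPn; exists j; first by rewrite inE gt_eqF.
  by rewrite inE negbK !evE; apply/eqP; ring.
by exists phi; split=> // i /f'Z /phiZ.
Qed.

End Cones.

(** * Walks and reachability in graphs *)

Section Walks.
Variables (T : eqType) (Vx : T -> Prop) (E : T -> T -> Prop).

(** Repeated vertices are allowed, so walks concatenate freely; [reachable_path] recovers a simple
    path. *)
Definition reachable u v :=
  exists s, [/\ forall z, z \in u :: s -> Vx z, is_walk E u s & last u s = v].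

Lemma is_walkP x s : is_walk E x s <-> path (fun a b => `[< E a b >]) x s.
Proof.
elim: s x => //= y s IH x; split.
  by move=> [/asboolP -> /IH].
by move=> /andP[/asboolP ? /IH].
Qed.

Lemma is_walk_cat x s t : is_walk E x (s ++ t) <-> is_walk E x s /\ is_walk E (last x s) t.
Proof.
by rewrite !is_walkP cat_path; split=> [/andP|[-> ->]].
Qed.

Lemma reachable_refl u : Vx u -> reachable u u.
Proof. by move=> Vu; exists [::]; split=> // z; rewrite inE => /eqP ->. Qed.

Lemma reachable1 u v : Vx u -> Vx v -> E u v -> reachable u v.
Proof.
by move=> Vu Vv Euv; exists [:: v]; split=> // z; rewrite !inE => /orP[] /eqP ->.
Qed.

Lemma reachable_trans u v z : reachable u v -> reachable v z -> reachable u z.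
Proof.
move=> [s [sV sE <-]] [t [tV tE <-]]; exists (s ++ t); split.
- move=> y; rewrite -cat_cons mem_cat => /orP[/sV //|yt].
  by apply: tV; rewrite inE yt orbT.
- exact/is_walk_cat.
- by rewrite last_cat.
Qed.

Lemma reachable_sym u v : (forall a b, E a b -> E b a) -> reachable u v -> reachable v u.
Proof.
move=> Esym [s [sV sE <-]] {v}; elim: s u sV sE => [|y s IH] u sV /=.
  by move=> _; apply/reachable_refl/sV; rewrite inE.
move=> [uy yE]; apply: (@reachable_trans _ y).
  by apply: IH => // z zs; apply: sV; rewrite inE zs orbT.
by apply: reachable1 (Esym _ _ uy); apply: sV; rewrite !inE eqxx ?orbT.
Qed.

Lemma reachable_path u v : reachable u v -> exists s, is_path Vx E u v s.
Proof.
move=> [s [sV /is_walkP sE <-]]; case: (shortenP sE) sV => t tE tU ts sV.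
exists t; split=> //; split; last by split=> //; apply/is_walkP.
move=> z; rewrite inE => /orP[/eqP ->|/ts zs]; apply: sV; rewrite inE ?eqxx //.
by rewrite zs orbT.
Qed.

End Walks.

Lemma reachable_sub (T : eqType) (Vx Vx' : T -> Prop) (E E' : T -> T -> Prop) u v :
  (forall z, Vx z -> Vx' z) -> (forall a b, E a b -> E' a b) ->
  reachable Vx E u v -> reachable Vx' E' u v.
Proof.
move=> VV EE [s [sV sE sv]]; exists s; split=> //; first by move=> z /sV /VV.
by elim: s u sE {sV sv} => //= y s IH u [/EE ? /IH].
Qed.

(** * Homogeneous coordinates, affine functionals and dimension *)

Section AffineFunctionals.
Variables (R : realType) (d : nat).
Local Notation pt := 'rV[R]_d.

Definition hom (x : pt) : 'rV[R]_(d + 1) := row_mx x 1%:M.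

Definition aff (f : 'cV[R]_(d + 1)) (x : pt) : R := (hom x *m f) 0 0.

Lemma aff_lin f x : aff f x = (x *m usubmx f) 0 0 + dsubmx f 0 0.
Proof. by rewrite /aff /hom -[f in LHS]vsubmxK mul_row_col mul1mx mxE. Qed.

Lemma affD f e x : aff (f + e) x = aff f x + aff e x.
Proof. by rewrite /aff mulmxDr mxE. Qed.

Lemma affZ c f x : aff (c *: f) x = c * aff f x.
Proof. by rewrite /aff -scalemxAr mxE. Qed.

Lemma aff_extrapolate f (x c : pt) t :
  aff f (x + t *: (x - c)) = aff f x + t * (aff f x - aff f c).
Proof. by rewrite !aff_lin mulmxDl -scalemxAl mulmxBl !mxE; ring. Qed.

Lemma hom_sub x y : hom x - hom y = (x - y) *m row_mx 1%:M 0.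
Proof. by rewrite /hom mul_mx_row mulmx1 mulmx0 opp_row_mx add_row_mx subrr. Qed.

Lemma hom_sum (I : finType) (c : I -> R) (x : I -> pt) : \sum_i c i = 1 ->
  hom (\sum_i c i *: x i) = \sum_i c i *: hom (x i).
Proof.
move=> c1; have homE y : hom y = y *m row_mx 1%:M 0 + hom 0.
  by rewrite -[y in RHS]subr0 -hom_sub subrK.
under [RHS]eq_bigr => i _ do rewrite homE scalerDr scalemxAl.
by rewrite big_split /= -scaler_suml c1 scale1r -mulmx_suml -homE.
Qed.

Lemma aff_sum f (I : finType) (c : I -> R) (x : I -> pt) : \sum_i c i = 1 ->
  aff f (\sum_i c i *: x i) = \sum_i c i * aff f (x i).
Proof.
move=> c1; rewrite /aff hom_sum // mulmx_suml summxE.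
by apply: eq_bigr => i _; rewrite -scalemxAl mxE.
Qed.

Lemma hom_neq0 x : hom x != 0.
Proof.
apply/eqP => /(congr1 rsubmx); rewrite row_mxKr => /matrixP/(_ 0 0).
by rewrite !mxE => /eqP; rewrite oner_eq0.
Qed.

(** The last coordinates are both 1, which forces the scalar to be 1. *)
Lemma hom_sub_line x y : (hom y <= hom x)%MS -> y = x.
Proof.
move=> /sub_rVP [c E].
have := congr1 lsubmx E; have := congr1 rsubmx E.
rewrite /hom scale_row_mx !row_mxKl !row_mxKr => /matrixP/(_ 0 0).
by rewrite !mxE /= mulr1 => <-; rewrite scale1r.
Qed.

Lemma dotE (a x : pt) : dot a x = (x *m a^T) 0 0.
Proof. by rewrite /dot mxE; apply: eq_bigr => i _; rewrite mxE mulrC. Qed.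

Section AffineIndependence.
Variables (k : nat) (p : 'I_k.+1 -> pt).
Let A := \matrix_(i < k.+1) hom (p i).
Let D := \matrix_(i < k) (p (lift ord0 i) - p ord0).

Lemma mul_hom_mx (u : 'rV[R]_k.+1) : \sum_j u 0 j = 0 ->
  u *m A = (\row_i u 0 (lift ord0 i)) *m D *m row_mx 1%:M 0.
Proof.
rewrite big_ord_recl => u0; rewrite mulmx_sum_row big_ord_recl rowK.
have -> : u 0 ord0 = - \sum_i u 0 (lift ord0 i).
  by apply/eqP; rewrite -addr_eq0 u0.
rewrite [_ *m D]mulmx_sum_row mulmx_suml scaleNr scaler_suml -sumrN -big_split /=.
apply: eq_bigr => i _; rewrite !rowK mxE -scalemxAl -hom_sub scalerBr addrC.
by [].
Qed.

(** The last coordinate makes the weights of a linear relation among homogenised points sum to zero,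
    so it is the same as a relation among the differences from [p ord0]. *)
Lemma affine_indepE : affine_indep p = row_free A.
Proof.
apply/idP/idP => free; apply: inj_row_free => u uE.
  have u0 : \sum_j u 0 j = 0.
    have := congr1 (fun M : 'rV_(d + 1) => rsubmx M 0 0) uE.
    rewrite mulmx_sum_row /= linear_sum summxE linear0 mxE; apply: etrans.
    by apply: eq_bigr => i _; rewrite rowK linearZ /= row_mxKr !mxE mulr1.
  have := mul_hom_mx u0; rewrite uE mul_mx_row mulmx0 mulmx1 -[X in X = _]row_mx0.
  move=> /eq_row_mx [/esym/eqP]; rewrite mulmx_free_eq0 // => /eqP u1 _.
  have u1E i : u 0 (lift ord0 i) = 0.
    by have /rowP/(_ i) := u1; rewrite !mxE.
  apply/rowP => j; rewrite mxE; case: (unliftP ord0 j) => [i ->//|->].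
  move: u0; rewrite big_ord_recl => /eqP; rewrite big1 ?addr0 => [/eqP //|i _].
  exact: u1E.
(* The weight at [ord0] is chosen to bring the total to zero. *)
pose u' := \row_j (if unlift ord0 j is Some i then u 0 i else - \sum_i u 0 i).
have u'E : \row_i u' 0 (lift ord0 i) = u.
  by apply/rowP => i; rewrite !mxE liftK.
have u'0 : \sum_j u' 0 j = 0.
  rewrite big_ord_recl !mxE unlift_none; apply/eqP; rewrite addrC subr_eq0; apply/eqP.
  by apply: eq_bigr => i _; rewrite mxE liftK.
have := mul_hom_mx u'0; rewrite u'E uE mul0mx => /eqP.
by rewrite mulmx_free_eq0 // => /eqP u'00; rewrite -u'E u'00; apply/rowP => i; rewrite !mxE.
Qed.

End AffineIndependence.

Lemma row_free_rowsub m n (f : 'I_n -> 'I_m) (A : 'M[R]_(m, d + 1)) :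
  injective f -> row_free A -> row_free (rowsub f A).
Proof.
move=> finj free; apply: inj_row_free => u.
rewrite rowsubE mulmxA => /eqP; rewrite mulmx_free_eq0 // => /eqP/rowP uE.
apply/rowP => i; have := uE (f i); rewrite !mxE (bigD1 i) //= big1 ?addr0.
  by rewrite !mxE eqxx mulr1.
by move=> j ji; rewrite !mxE (inj_eq finj) (negbTE ji) mulr0.
Qed.

(** [has_dim] excludes only independent families of exactly [k.+2] points, so a longer family is
    truncated to its first [k.+2] members. *)
Lemma has_dim_leq (S : pt -> Prop) k m (p : 'I_m.+1 -> pt) : has_dim S k ->
  (forall i, S (p i)) -> affine_indep p -> (m <= k)%N.
Proof.
move=> [_ noS] pS; rewrite affine_indepE => pfree; rewrite leqNgt; apply/negP => lt_km.
apply: noS; have le_km : (k.+2 <= m.+1)%N by [].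
exists (p \o widen_ord le_km); split=> [i|]; first exact: pS.
rewrite affine_indepE.
have -> : \matrix_(i < k.+2) hom ((p \o widen_ord le_km) i) =
          rowsub (widen_ord le_km) (\matrix_(i < m.+1) hom (p i)).
  by apply/matrixP => i j; rewrite !mxE.
by apply: row_free_rowsub => // i j /(congr1 val) /= /val_inj.
Qed.

Lemma has_dim_span (S : pt -> Prop) k m (B : 'M_(m, d + 1)) (p : 'I_k.+1 -> pt) :
  (forall i, S (p i)) -> row_free (\matrix_(i < k.+1) hom (p i)) ->
  (forall x, S x -> (hom x <= B)%MS) -> (\rank B <= k.+1)%N -> has_dim S k.
Proof.
move=> pS pfree SB rB; split; first by exists p; rewrite affine_indepE.
move=> [q [qS]]; rewrite affine_indepE /row_free => /eqP qfree.
suff : (k.+2 <= \rank B)%N by move=> /leq_trans/(_ rB); rewrite ltnn.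
by rewrite -qfree; apply/mxrankS/row_subP => i; rewrite rowK; apply/SB/qS.
Qed.

Lemma has_dim0_eq (S : pt -> Prop) x y : has_dim S 0 -> S x -> S y -> x = y.
Proof.
move=> [_ noS] Sx Sy; apply/eqP; apply: contrapT => /negP xy; apply: noS.
exists (fun i => if i == ord0 then x else y); split=> [i|]; first by case: ifP.
rewrite /affine_indep; set M := \matrix_(i < 1) _.
have -> : M = y - x by apply/rowP => j; rewrite !mxE.
by rewrite /row_free rank_rV subr_eq0 [y == x]eq_sym xy.
Qed.

End AffineFunctionals.

(** * Faces of a polytope as zero sets of nonnegative affine functionals *)

Section Faces.
Variables (R : realType) (d : nat) (V : seq 'rV[R]_d).
Local Notation pt := 'rV[R]_d.
Local Notation P := (conv V).

Definition homV (i : 'I_(size V)) : 'rV[R]_(d + 1) := hom V`_i.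

Definition zero_face (f : 'cV[R]_(d + 1)) : pt -> Prop := fun x => P x /\ aff f x = 0.

Lemma conv_nth (i : 'I_(size V)) : P V`_i.
Proof.
exists (fun j => (j == i)%:R); split=> [j|]; first exact: ler0n.
split; first by rewrite (bigD1 i) //= eqxx big1 ?addr0 // => j /negbTE ->.
rewrite (bigD1 i) //= eqxx scale1r big1 ?addr0 // => j /negbTE ->.
by rewrite scale0r.
Qed.

Lemma aff_conv_ge0 f x : nonneg homV f -> P x -> 0 <= aff f x.
Proof.
move=> f0 [c [c0 [c1 ->]]]; rewrite aff_sum //; apply: sumr_ge0 => i _.
by rewrite mulr_ge0 // f0.
Qed.

(** A vanishing sum of nonnegative terms has only zero terms, so the weights live on the listed
    points of the face. *)
Lemma zero_faceP f x : nonneg homV f -> zero_face f x ->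
  exists c : 'I_(size V) -> R, [/\ \sum_i c i = 1, x = \sum_i c i *: V`_i &
    forall i, c i != 0 -> aff f V`_i = 0].
Proof.
move=> f0 [[c [c0 [c1 ->]]] fx]; exists c; split=> // i ci.
move: fx; rewrite aff_sum // => /eqP; rewrite psumr_eq0; last first.
  by move=> j _; rewrite mulr_ge0 // f0.
move=> /allP/(_ i (mem_index_enum i)) /=; rewrite mulf_eq0 (negbTE ci) /=.
by move=> /eqP.
Qed.

Lemma zero_face_vertex f x : nonneg homV f -> zero_face f x ->
  exists i : 'I_(size V), aff f V`_i = 0.
Proof.
move=> f0 /(zero_faceP f0) [c [c1 _ cZ]]; apply: contrapT => /forallNP H.
have : \sum_i c i = 0.
  apply: big1 => i _; apply/eqP; apply: contrapT => /negP/cZ; exact: H.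
by rewrite c1 => /eqP; rewrite oner_eq0.
Qed.

Lemma zero_face_span f m (B : 'M_(m, d + 1)) x : nonneg homV f ->
  (forall i : 'I_(size V), aff f V`_i = 0 -> (hom V`_i <= B)%MS) ->
  zero_face f x -> (hom x <= B)%MS.
Proof.
move=> f0 fB /(zero_faceP f0) [c [c1 -> cZ]]; rewrite hom_sum //.
apply: summx_sub => i _; have [->|/cZ/fB] := eqVneq (c i) 0.
  by rewrite scale0r sub0mx.
exact: scalemx_sub.
Qed.

Lemma functional_face f : nonneg homV f -> (exists i : 'I_(size V), aff f V`_i = 0) ->
  is_face P (zero_face f).
Proof.
move=> f0 [i0 fi0]; have [uf|uf] := eqVneq (usubmx f) 0.
  (* Without linear part there is no hyperplane; [f] is then constant, and zero because it vanishes
     at [i0], so the face is [P] itself. *)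
  left=> x; split=> [[]//|Px]; split=> //.
  by move: fi0; rewrite !aff_lin uf !mulmx0.
right; exists (- (usubmx f)^T), (dsubmx f 0 0).
have dotf x : dot (- (usubmx f)^T) x = dsubmx f 0 0 - aff f x.
  by rewrite dotE linearN /= trmxK mulmxN aff_lin mxE; ring.
split; first by rewrite oppr_eq0 trmx_eq0.
split=> x; rewrite dotf.
  by move=> /(aff_conv_ge0 f0); rewrite lerBlDr lerDl.
by split=> -[Px E]; split=> //; [rewrite E subr0 | lra].
Qed.

Lemma face_functional F : is_face P F ->
  exists2 f, nonneg homV f & forall x, F x <-> zero_face f x.
Proof.
case=> [FP|[a [b [_ [aP aF]]]]].
  have aff0 x : aff 0 x = 0 by rewrite /aff mulmx0 mxE.
  exists 0 => [i|x]; first by rewrite -[ev _ _ _]/(aff 0 V`_i) aff0.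
  by rewrite FP /zero_face aff0; split=> [|[]].
have affE x : aff (col_mx (- a^T) b%:M) x = b - dot a x.
  by rewrite aff_lin col_mxKu col_mxKd mulmxN dotE !mxE mulr1n addrC.
exists (col_mx (- a^T) b%:M) => [i|x].
  by rewrite -[ev _ _ _]/(aff _ V`_i) affE subr_ge0; apply/aP/conv_nth.
by rewrite aF /zero_face affE; split=> -[Px E]; split=> //; lra.
Qed.

Lemma has_dim0_zero_face f (p : 'I_(size V)) : nonneg homV f -> aff f V`_p = 0 ->
  (forall i : 'I_(size V), aff f V`_i = 0 -> V`_i = V`_p) -> has_dim (zero_face f) 0.
Proof.
move=> f0 fp fZ; apply: (@has_dim_span _ _ _ _ _ (hom V`_p) (fun=> V`_p)).
- by move=> _; split=> //; apply: conv_nth.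
- apply: inj_row_free => u; rewrite mulmx_sum_row big_ord1 rowK => /eqP.
  rewrite scaler_eq0 (negbTE (hom_neq0 _)) orbF => /eqP u0.
  by apply/rowP => i; rewrite ord1 u0 mxE.
- by move=> x; apply: zero_face_span => // i /fZ ->.
- exact: rank_leq_row.
Qed.

Lemma has_dim1_zero_face f (p q : 'I_(size V)) : nonneg homV f ->
  aff f V`_p = 0 -> aff f V`_q = 0 -> V`_p != V`_q ->
  (forall i : 'I_(size V), aff f V`_i = 0 -> (hom V`_i <= hom V`_p + hom V`_q)%MS) ->
  has_dim (zero_face f) 1.
Proof.
move=> f0 fp fq pq fZ.
apply: (@has_dim_span _ _ _ _ _ (hom V`_p + hom V`_q)%MS
  (fun i => if i == ord0 then V`_p else V`_q)).
- by move=> i; case: ifP => _; split=> //; apply: conv_nth.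
- rewrite -affine_indepE /affine_indep; set M := \matrix_(i < 1) _.
  have -> : M = V`_q - V`_p by apply/rowP => j; rewrite !mxE.
  by rewrite /row_free rank_rV subr_eq0 [V`_q == _]eq_sym pq.
- by move=> x; apply: zero_face_span.
- apply: leq_trans (mxrank_adds_leqif _ _) _.
  by rewrite (leq_add (rank_leq_row _) (rank_leq_row _)).
Qed.

(** The rows of [B] are the homogenised points on the facet. The functionals that kill them form the
    line of [phi], so [B] has rank [d], and [d] independent rows are the required points. *)
Lemma has_dim_facet phi : (0 < d)%N -> facet_functional homV phi ->
  has_dim (zero_face phi) d.-1.
Proof.
move=> d0 [phi0 phin0 phiF].
pose Z := [set i | aff phi (V`_(i : 'I_(size V))) == 0].
pose B := \matrix_(j < #|Z|) homV (enum_val j).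
have Bphi : B *m phi = 0.
  apply/row_matrixP => j; rewrite row_mul rowK linear0.
  have := enum_valP j; rewrite inE => /eqP H.
  by apply/matrixP => a b; rewrite !ord1 [LHS]H mxE.
have coB : (\rank (cokermx B) = 1)%N.
  apply/eqP; rewrite eqn_leq; apply/andP; split.
    rewrite -mxrank_tr; apply: leq_trans (rank_leq_row phi^T); apply/mxrankS/row_subP => j.
    have [|c E] := phiF (row j (cokermx B)^T)^T.
      move=> i phii; have iZ : i \in Z by rewrite inE; apply/eqP.
      have Bi : homV i = row (enum_rank_in iZ i) B by rewrite rowK enum_rankK_in.
      rewrite /ev Bi -tr_col trmxK colE -row_mul mulmxA mulmx_coker mul0mx.
      by rewrite !mxE.
    by rewrite -[row _ _]trmxK E linearZ scalemx_sub.
  rewrite lt0n mxrank_coker; apply: contra phin0; rewrite subn_eq0 => full.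
  have fullB : row_full B by rewrite /row_full eqn_leq rank_leq_col.
  by apply/eqP/(row_full_inj fullB); rewrite Bphi mulmx0.
have rB : \rank B = d.-1.+1.
  rewrite prednK //; have := rank_leq_col B; move: coB; rewrite mxrank_coker; lia.
have [f ffree] : exists f : 'I_(d.-1.+1) -> 'I_#|Z|, row_free (rowsub f B).
  by rewrite -rB; exists (maxrankfun B); apply: maxrowsub_free.
apply: (@has_dim_span _ _ _ _ _ B (fun i => V`_(enum_val (f i)))).
- move=> i; split; first exact: conv_nth.
  by have := enum_valP (f i); rewrite inE => /eqP.
- suff <- : rowsub f B = \matrix_i hom V`_(enum_val (f i)) by [].
  by apply/row_matrixP => i; rewrite row_rowsub !rowK.
- move=> x; apply: zero_face_span => // i fi.
  have iZ : i \in Z by rewrite inE; apply/eqP.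
  suff -> : hom V`_i = row (enum_rank_in iZ i) B by apply: row_sub.
  by rewrite rowK enum_rankK_in.
- by rewrite rB.
Qed.

End Faces.

(** * The graph of a polytope and Balinski's theorem *)

Section PolytopeGraph.
Variables (R : realType) (d : nat) (V : seq 'rV[R]_d).
Local Notation pt := 'rV[R]_d.
Local Notation P := (conv V).
Local Notation I := 'I_(size V).
Local Notation hv := (@homV R d V).

Lemma homV_pointed : exists g, forall i : I, 0 < ev hv g i.
Proof.
exists (col_mx 0 1%:M) => i.
by rewrite -[ev _ _ _]/(aff _ _) aff_lin col_mxKu col_mxKd mulmx0 !mxE add0r ltr01.
Qed.

(** [V] may list points twice and contain points that are not vertices; vertices correspond to the
    indices that span extreme rays. *)
Lemma pvertex_ray x : pvertex P x -> exists2 p : I, V`_p = x & ray hv p.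
Proof.
move=> [F [/face_functional [f f0 Ff] [F0 Fx]]].
have [p fp] := zero_face_vertex f0 (proj1 (Ff x) Fx).
have fZ (i : I) : aff f V`_i = 0 -> V`_i = x.
  move=> fi; apply: (has_dim0_eq F0) => //; apply/Ff; split=> //; exact: conv_nth.
exists p; first exact: fZ.
exists f; split=> // i /fZ Vi; rewrite /parallel /homV Vi -(fZ p) //.
Qed.

Lemma ray_pvertex (p : I) : ray hv p -> pvertex P V`_p.
Proof.
move=> [h [h0 hp hZ]]; exists (zero_face V h); split.
  by apply: functional_face => //; exists p.
split; last by split=> //; apply: conv_nth.
by apply: has_dim0_zero_face hp _ => // i /hZ /hom_sub_line.
Qed.

Lemma cone_edge_pedge (p q : I) : cone_edge hv p q -> pedge P V`_p V`_q.
Proof.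
move=> [rp rq npq [k [k0 kp kq kZ]]].
have pq : V`_p != V`_q by apply: contraNneq npq => E; rewrite /parallel /homV E.
split; first exact: ray_pvertex.
split; first exact: ray_pvertex.
split=> //; exists (zero_face V k); split.
  by apply: functional_face => //; exists p.
split; first exact: (has_dim1_zero_face k0 kp kq pq).
by split; split=> //; apply: conv_nth.
Qed.

Lemma pedge_sym u v : pedge P u v -> pedge P v u.
Proof.
move=> [Vu [Vv [uv [F [? [? [Fu Fv]]]]]]]; split=> //; split=> //.
by rewrite eq_sym; split=> //; exists F.
Qed.

Lemma lk_edge_sym x u v : lk_edge P x u v -> lk_edge P x v u.
Proof.
move=> [Vu [Vv [uv [F [? [? [Fu [Fv H]]]]]]]]; split=> //; split=> //.
by rewrite eq_sym; split=> //; exists F.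
Qed.

Lemma lk_vertex_pvertex x v : lk_vertex P x v -> pvertex P v.
Proof. by move=> [F [? [? [? _]]]]; exists F. Qed.

Lemma lk_vertex_neq x v : lk_vertex P x v -> v != x.
Proof. by move=> [F [_ [_ [Fv [Fx _]]]]]; apply/eqP => E; apply: Fx; rewrite -E. Qed.

Lemma lk_edge_pedge x u v : lk_edge P x u v -> pedge P u v.
Proof.
move=> [/lk_vertex_pvertex Vu [/lk_vertex_pvertex Vv [uv [F [? [? [Fu [Fv _]]]]]]]].
by do 3!split=> //; exists F.
Qed.

Hypothesis dimP : has_dim P d.

Lemma homV_spanning f : (forall i, ev hv f i = 0) -> f = 0.
Proof.
move=> fV; have [[p [pP free]] _] := dimP; rewrite affine_indepE in free.
have fP x : P x -> aff f x = 0.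
  move=> [c [_ [c1 ->]]]; rewrite aff_sum // big1 // => i _.
  by rewrite [aff _ _]fV mulr0.
have pf : \matrix_(i < d.+1) hom (p i) *m f = 0.
  apply/row_matrixP => i; rewrite row_mul rowK linear0.
  by apply/matrixP => a b; rewrite !ord1 [LHS]fP ?mxE.
have full : row_full (\matrix_(i < d.+1) hom (p i)).
  by rewrite /row_full (eqP free) addn1.
by apply: (row_full_inj full); rewrite pf mulmx0.
Qed.

Lemma exists_aff_neq0 f : f != 0 -> exists i : I, aff f V`_i != 0.
Proof.
move=> f0; apply: contrapT => /forallNP H; case/eqP: f0; apply: homV_spanning => i.
by apply/eqP; apply: contrapT => /negP; apply: H.
Qed.

(** [u] and [Y] impose at most [d] linear conditions in dimension [d + 1], so a nonzero affine
    functional vanishes on all of them; points off its zero set avoid [Y]. *)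
Lemma pvertices_connected (Y : seq pt) u v : (size Y < d)%N ->
  pvertex P u /\ u \notin Y -> pvertex P v /\ v \notin Y ->
  reachable (fun z => pvertex P z /\ z \notin Y) (pedge P) u v.
Proof.
move=> Yd [/pvertex_ray [p <- rp] uY] [/pvertex_ray [q <- rq] vY].
have [g g0] := homV_pointed.
have [|f [f0 fY]] := @exists_annihilator _ _ [seq hom y | y <- V`_p :: Y].
  by rewrite size_map /= addn1.
have {}fY y : y \in V`_p :: Y -> aff f y = 0.
  by move=> yY; rewrite /aff fY ?mxE // map_f.
pose ok (i : I) := V`_i \notin Y.
pose C (a b : I) := reachable (fun z => pvertex P z /\ z \notin Y) (pedge P) V`_a V`_b.
apply: (@connected_off_hyperplane _ _ _ _ _ g0 ok C) => //.
- by move=> a b; apply/reachable_sym/pedge_sym.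
- by move=> a b c; apply: reachable_trans.
- move=> a b oka _ /ray_pvertex ra _ /hom_sub_line E.
  by rewrite /C E; apply: reachable_refl.
- move=> a b oka okb ab; apply: reachable1 (cone_edge_pedge ab); split=> //;
    by apply: ray_pvertex; case: ab.
- move=> i; apply: contraNN => iY; apply/eqP; apply: fY; rewrite inE iY orbT //.
- exact: exists_aff_neq0.
- by apply: fY; rewrite inE eqxx.
Qed.

(** At most [d] vertices are annihilated by some nonzero functional. After a change of sign it is
    positive somewhere, so it is maximal at a vertex that is not yet listed. *)
Lemma exists_pvertices : exists s : seq pt,
  uniq s /\ size s = d.+1 /\ forall z, z \in s -> pvertex P z.
Proof.
have [g g0] := homV_pointed.
suff H k : (k <= d.+1)%N -> exists s : seq pt,
    uniq s /\ size s = k /\ forall z, z \in s -> pvertex P z by exact: H.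
elim: k => [|k IH] lek; first by exists [::].
have [s [sU [sk sV]]] := IH (ltnW lek).
have [|f [f0 fs]] := @exists_annihilator _ _ [seq hom y | y <- s].
  by rewrite size_map sk addn1.
have {}fs y : y \in s -> aff f y = 0.
  by move=> ys; rewrite /aff fs ?mxE // map_f.
suff [p rp fp] : exists2 p, ray hv p & aff f V`_p != 0.
  exists (V`_p :: s); split; last split=> [|z]; rewrite /= ?sk ?sU ?andbT //.
    by apply: contraNN fp => /fs ->.
  by rewrite inE => /orP[/eqP ->|/sV //]; apply: ray_pvertex.
wlog [i fi] : f f0 {fs} / exists i : I, 0 < aff f V`_i.
  move=> W; have [i] := exists_aff_neq0 f0.
  rewrite neq_lt => /orP[] fi; last by apply: W => //; exists i.
  have affN j : aff (- f) V`_j = - aff f V`_j by rewrite /aff mulmxN mxE.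
  have [||p rp] := W (- f); rewrite ?oppr_eq0 //.
    by exists i; rewrite affN oppr_gt0.
  by rewrite affN oppr_eq0 => fp; exists p.
have [m rm mmax] := exists_max_ray g0 f (ex_intro _ i isT).
exists m => //; apply/eqP; rewrite -[aff _ _]/(ev hv f m) => fm.
have := mmax i; rewrite fm mul0r leNgt => /negP; apply.
by rewrite mulr_gt0.
Qed.

End PolytopeGraph.

Lemma mem_sub_mx (R : fieldType) n (s : seq 'rV[R]_n) y : y \in s ->
  (y <= \matrix_(j < size s) s`_j)%MS.
Proof.
move=> ys; have lt_y : (index y s < size s)%N by rewrite index_mem.
have := row_sub (Ordinal lt_y) (\matrix_(j < size s) s`_j).
by rewrite rowK /= nth_index.
Qed.

Lemma small_perturbation (R : realFieldType) (a b : R) : 0 < a ->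
  exists2 e, 0 < e & forall t, 0 < t -> t <= e -> 0 < a + t * b.
Proof.
move=> a0; have b1 : 0 < 1 + `|b| by rewrite ltr_pwDl.
exists (a / (1 + `|b|)); first exact: divr_gt0.
move=> t t0; rewrite ler_pdivlMr // => H.
have : t * - b <= t * `|b| by rewrite ler_pM2l // -normrN ler_norm.
by lra.
Qed.

(** * The link of a vertex, seen from a point just beyond it *)

Section Link.
Variables (R : realType) (d : nat) (V : seq 'rV[R]_d).
Local Notation pt := 'rV[R]_d.
Local Notation P := (conv V).
Local Notation I := 'I_(size V).
Local Notation hv := (@homV R d V).
Hypothesis dimP : has_dim P d.
Variable x : pt.
Hypothesis Vx : pvertex P x.

(** The average of the listed points serves as an interior point, away from which [x] is pushed. *)
Let c : pt := \sum_(i < size V) (size V)%:R^-1 *: V`_i.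

Lemma aff_barycenter_gt0 f : nonneg hv f -> f != 0 -> 0 < aff f c.
Proof.
move=> f0 fn0; have [i fi] := exists_aff_neq0 dimP fn0.
have sz : 0 < (size V)%:R :> R by rewrite ltr0n (leq_ltn_trans _ (ltn_ord i)).
rewrite aff_sum; last first.
  by rewrite sumr_const card_ord -[LHS]mulr_natl mulfV // gt_eqF.
rewrite (bigD1 i) //= ltr_pwDl //; last first.
  by apply: sumr_ge0 => j _; rewrite mulr_ge0 ?invr_ge0 ?ler0n ?f0.
by rewrite mulr_gt0 ?invr_gt0 // lt_neqAle eq_sym fi f0.
Qed.

Definition apex t : pt := x + t *: (x - c).

(* For small [t] the apex lies beyond exactly the facets through [x]. *)
Lemma exists_apex : exists2 t, 0 < t &
  (forall phi, facet_functional hv phi -> 0 < aff phi x -> 0 < aff phi (apex t)) /\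
  (forall p : I, ray hv p -> V`_p != x -> exists h, [/\ nonneg hv h, aff h V`_p = 0,
     forall i : I, aff h V`_i = 0 -> V`_i = V`_p & 0 < aff h (apex t)]).
Proof.
(* There are infinitely many facet functionals but finitely many zero sets, and functionals with the
   same zero set are proportional; so one bound on [t] per subset and one per index suffice. *)
pose Q (s : {set I} + I) t := match s with
  | inl Z => forall phi, facet_functional hv phi -> [set i | ev hv phi i == 0] = Z ->
       0 < aff phi x -> 0 < aff phi (apex t)
  | inr p => ray hv p -> V`_p != x -> exists h, [/\ nonneg hv h, aff h V`_p = 0,
     forall i : I, aff h V`_i = 0 -> V`_i = V`_p & 0 < aff h (apex t)] end.
have [px pxE _] := pvertex_ray Vx.
have [|t t0 tQ] := @exists_uniform_eps R _ Q; last first.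
  exists t => //; split=> [phi Fphi|p]; last exact: (tQ (inr p)).
  exact: (tQ (inl [set i | ev hv phi i == 0])).
case=> [Z|p].
  have [[psi [Fpsi psiZ psix]]|noZ] := pselect (exists psi,
    [/\ facet_functional hv psi, [set i | ev hv psi i == 0] = Z & 0 < aff psi x]); last first.
    by exists 1 => // t _ _ phi Fphi phiZ phix; case: noZ; exists phi.
  have [e e0 He] := small_perturbation (aff psi x - aff psi c) psix.
  exists e => // t t0 te phi [phi0 phin0 phiF] phiZ phix.
  case: Fpsi => psi0 _ psiF; have [i phii|k phiE] := psiF phi.
    have : i \in Z by rewrite -psiZ inE phii.
    by rewrite -phiZ inE => /eqP.
  move: phix; rewrite phiE !affZ => H.
  have k0 : 0 < k by rewrite -(pmulr_lgt0 _ psix).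
  by rewrite pmulr_rgt0 // aff_extrapolate; apply: He.
have [[h [h0 hp hZ]]|nr] := pselect (ray hv p); last first.
  by exists 1 => // t _ _ /nr.
have [px'|npx] := eqVneq V`_p x.
  by exists 1 => // t _ _ _; rewrite px' eqxx.
have hZ' (i : I) : aff h V`_i = 0 -> V`_i = V`_p by move=> /hZ /hom_sub_line.
have hx : 0 < aff h x.
  rewrite lt_neqAle -pxE; apply/andP; split; last exact: h0.
  by apply: contraNneq npx => /esym/hZ' <-; rewrite pxE.
have [e e0 He] := small_perturbation (aff h x - aff h c) hx.
by exists e => // t t0 te _ _; exists h; split=> //; rewrite aff_extrapolate; apply: He.
Qed.

Section Apex.
Variable t : R.
Hypothesis t_gt0 : 0 < t.
Local Notation o := (apex t).
Hypothesis apex_facet :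
  forall phi, facet_functional hv phi -> 0 < aff phi x -> 0 < aff phi o.
Hypothesis apex_vertex : forall p : I, ray hv p -> V`_p != x ->
  exists h, [/\ nonneg hv h, aff h V`_p = 0,
     forall i : I, aff h V`_i = 0 -> V`_i = V`_p & 0 < aff h o].

Definition from_apex (i : I) : pt := V`_i - o.
Local Notation w := from_apex.

(** Functionals on the cone with apex [o] become affine functionals on [P] that vanish at [o]. *)
Definition lift_apex (a : 'cV[R]_d) : 'cV[R]_(d + 1) := col_mx a (- (o *m a)).

Lemma aff_lift_apex a y : aff (lift_apex a) y = ((y - o) *m a) 0 0.
Proof. by rewrite aff_lin col_mxKu col_mxKd mulmxBl !mxE. Qed.

Lemma aff_lift_apex0 a : aff (lift_apex a) o = 0.
Proof. by rewrite aff_lift_apex subrr mul0mx mxE. Qed.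

Lemma ev_from_apex a i : ev w a i = aff (lift_apex a) V`_i.
Proof. by rewrite aff_lift_apex. Qed.

Lemma ev_from_apex_aff f i : ev w (usubmx f) i = aff f V`_i - aff f o.
Proof. by rewrite /ev /w mulmxBl !aff_lin !mxE; ring. Qed.

(** If the lift were zero, all generators would lie in the span of fewer than [d] vectors, and a
    functional that annihilates these would confine [P] to a hyperplane through [o]. *)
Lemma lift_apex_neq0 a (s : seq pt) : (size s < d)%N ->
  (forall i, ev w a i = 0 -> (w i <= \matrix_(j < size s) s`_j)%MS) ->
  lift_apex a != 0.
Proof.
move=> sd aZ; apply/eqP => la0.
have [b [b0 bs]] := exists_annihilator sd.
case/eqP: b0; suff /(congr1 usubmx) : lift_apex b = 0 by rewrite col_mxKu linear0.
apply: (homV_spanning dimP) => i; rewrite -[ev _ _ _]/(aff _ _) aff_lift_apex.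
have /aZ /submxP [D wi] : ev w a i = 0 by rewrite ev_from_apex la0 /aff mulmx0 mxE.
rewrite -[_ - _]/(w i) wi -mulmxA.
suff -> : (\matrix_(j < size s) s`_j) *m b = 0 by rewrite mulmx0 mxE.
by apply/row_matrixP => j; rewrite row_mul rowK linear0 bs // mem_nth.
Qed.

(** As [x] lies strictly between [o] and the interior point [c], a supporting hyperplane through [o]
    misses [x]. The face lies in a facet that is not positive at [o]; by the choice of [o] this
    facet contains [x], and then it is strictly negative at [o]. *)
Lemma apex_face f : nonneg hv f -> f != 0 -> aff f o = 0 -> (0 < d)%N ->
  0 < aff f x /\ exists phi, [/\ facet_functional hv phi, aff phi x = 0, aff phi o < 0 &
    forall i : I, aff f V`_i = 0 -> aff phi V`_i = 0].
Proof.
move=> f0 fn0 fo d0; split.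
  have := aff_barycenter_gt0 f0 fn0 => fc.
  move: fo; rewrite aff_extrapolate => E.
  have : 0 < aff f x * (1 + t) by have := mulr_gt0 t_gt0 fc; lra.
  by rewrite pmulr_lgt0 // ltr_pwDl // ltW.
have [|phi [Fphi phio phiZ]] := facet_above (homV_spanning dimP) (o := hom o) f0 fn0.
  by rewrite [X in X <= _]fo.
have phix : aff phi x = 0.
  have [px pxE _] := pvertex_ray Vx.
  apply/eqP; rewrite eq_le -{2}pxE; apply/andP; split; last by case: Fphi => phi0 _ _; apply: phi0.
  by rewrite leNgt; apply/negP => /(apex_facet Fphi); rewrite ltNge [X in ~~ X -> _]phio.
exists phi; split=> //; rewrite aff_extrapolate phix.
have [phi0 phin0 _] := Fphi; have := mulr_gt0 t_gt0 (aff_barycenter_gt0 phi0 phin0).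
by lra.
Qed.

Lemma ray_apex_functional p : (1 < d)%N -> ray w p -> exists f,
  [/\ nonneg hv f, f != 0, aff f o = 0 & forall i : I, parallel w p i <-> aff f V`_i = 0].
Proof.
move=> d1 [h [h0 hp hZ]]; exists (lift_apex h); split.
- by move=> i; rewrite -[ev _ _ _]/(aff _ _) -ev_from_apex.
- apply: (@lift_apex_neq0 h [:: w p]) => // i /hZ; rewrite /parallel => H.
  by apply: submx_trans H (mem_sub_mx _); rewrite inE.
- exact: aff_lift_apex0.
- by move=> i; rewrite -ev_from_apex; split=> [/ev_parallel/(_ hp)|/hZ].
Qed.

(** The facet functional [phi] vanishes at both points but not at [o], so the line through [o] meets
    the facet only once. *)
Lemma parallel_apex_eq p q : (1 < d)%N -> ray w p -> parallel w p q -> V`_q = V`_p.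
Proof.
move=> d1 /(ray_apex_functional d1) [f [f0 fn0 fo fZ]] pq.
have [_ [phi [_ _ phio phiZ]]] := apex_face f0 fn0 fo (ltnW d1).
have phip : aff phi V`_p = 0 by apply/phiZ/fZ/submx_refl.
have phiq : aff phi V`_q = 0 by apply/phiZ/fZ.
have /sub_rVP [k Ek] := pq.
have : ev w (usubmx phi) q = k * ev w (usubmx phi) p by rewrite /ev Ek -scalemxAl mxE.
rewrite !ev_from_apex_aff phip phiq !sub0r -[X in X = _]mul1r => /mulIf.
rewrite oppr_eq0 lt_eqF // => /(_ isT) k1.
by move: Ek; rewrite -k1 scale1r => /addIr.
Qed.

Lemma zero_face_link f : nonneg hv f -> f != 0 -> aff f o = 0 -> (0 < d)%N ->
  ~ zero_face V f x /\
  exists G, is_facet P G /\ G x /\ forall y, zero_face V f y -> G y.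
Proof.
move=> f0 fn0 fo d0.
have [fx [phi [Fphi phix _ phiZ]]] := apex_face f0 fn0 fo d0.
split; first by move=> [_ fx0]; rewrite fx0 ltxx in fx.
have [px pxE _] := pvertex_ray Vx; have [phi0 _ _] := Fphi.
exists (zero_face V phi); split; last split.
- split; last exact: has_dim_facet.
  by apply: functional_face => //; exists px; rewrite pxE.
- by split=> //; rewrite -pxE; apply: conv_nth.
- move=> y Fy; have [Py _] := Fy; split=> //.
  have [k [k1 -> kZ]] := zero_faceP f0 Fy; rewrite aff_sum // big1 // => i _.
  by have [->|/kZ/phiZ ->] := eqVneq (k i) 0; rewrite ?mul0r ?mulr0.
Qed.

Lemma ray_lk_vertex p : (1 < d)%N -> ray w p -> lk_vertex P x V`_p.
Proof.
move=> d1 rp; have [f [f0 fn0 fo fZ]] := ray_apex_functional d1 rp.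
have fp : aff f V`_p = 0 by apply/fZ/submx_refl.
have [nFx G] := zero_face_link f0 fn0 fo (ltnW d1).
exists (zero_face V f); split; first by apply: functional_face => //; exists p.
split; first by apply: (has_dim0_zero_face f0 fp) => i /fZ /(parallel_apex_eq d1 rp).
by split; first by split=> //; apply: conv_nth.
Qed.

Lemma cone_edge_lk_edge p q : (2 < d)%N -> cone_edge w p q -> lk_edge P x V`_p V`_q.
Proof.
move=> d2 [rp rq npq [k [k0 kp kq kZ]]]; have d1 := ltnW d2.
have pq : V`_p != V`_q by apply: contraNneq npq => E; rewrite /parallel /w E.
pose f := lift_apex k.
have f0 : nonneg hv f by move=> i; rewrite -[ev _ _ _]/(aff _ _) -ev_from_apex.
have fn0 : f != 0.
  apply: (@lift_apex_neq0 k [:: w p; w q]) => // i /kZ H.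
  apply: submx_trans H _; by rewrite addsmx_sub !mem_sub_mx ?inE ?eqxx ?orbT.
have fo : aff f o = 0 by exact: aff_lift_apex0.
have fp : aff f V`_p = 0 by rewrite -ev_from_apex.
have fq : aff f V`_q = 0 by rewrite -ev_from_apex.
have [_ [phi [_ _ phio phiZ]]] := apex_face f0 fn0 fo (ltnW d1).
split; first exact: ray_lk_vertex.
split; first exact: ray_lk_vertex.
split=> //; exists (zero_face V f); split.
  by apply: functional_face => //; exists p.
split; last first.
  by have := zero_face_link f0 fn0 fo (ltnW d1); do 2 (split; first by split=> //; apply: conv_nth).
apply: (has_dim1_zero_face f0 fp fq pq) => i fi.
have /sub_addsmxP [[a b] /= wi] := kZ i (etrans (ev_from_apex k i) fi).
rewrite (mx11_scalar a) (mx11_scalar b) !mul_scalar_mx in wi.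
move: (a 0 0) (b 0 0) wi => {}a {}b wi.
(* All three points satisfy [phi = 0] while [phi] is nonzero at [o]; the plane through [o] thus
   meets the facet in a line. *)
have ab : a + b = 1.
  have : ev w (usubmx phi) i = a * ev w (usubmx phi) p + b * ev w (usubmx phi) q.
    by rewrite /ev wi mulmxDl -!scalemxAl !mxE.
  rewrite !ev_from_apex_aff !phiZ // !sub0r -mulrDl -[X in X = _]mul1r => /mulIf.
  by rewrite oppr_eq0 lt_eqF // => /(_ isT).
have -> : hom V`_i = a *: hom V`_p + b *: hom V`_q.
  have -> : V`_i = a *: V`_p + b *: V`_q.
    move: wi; rewrite /w; move: {+}(apex t) => z /(canRL (subrK _)) ->.
    by rewrite !scalerBr addrACA -opprD -scalerDl ab scale1r subrK.
  have -> : b = 1 - a by lra.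
  rewrite /hom !scale_row_mx add_row_mx; congr row_mx.
  by rewrite -scalerDl addrC subrK scale1r.
by rewrite addmx_sub_adds ?scalemx_sub.
Qed.

(** The functional [h] exposes [u] and is positive at [o]; the functional [k] of the edge is
    negative there. A positive combination vanishes at [o] and still exposes [u]. *)
Lemma neighbour_ray u : (1 < d)%N -> pedge P x u -> exists2 p : I, V`_p = u & ray w p.
Proof.
move=> d1 [_ [Vu [xu [F [faceF [dimF [Fx Fu]]]]]]].
have [p pu rp] := pvertex_ray Vu.
have [|h [h0 hp hZ ho]] := apex_vertex rp; first by rewrite pu eq_sym.
have [k k0 Fk] := face_functional faceF.
have kn0 : k != 0.
  apply/eqP => k00; have [[q [qP free]] _] := dimP.
  suff : (d <= 1)%N by rewrite leqNgt d1.
  apply: (has_dim_leq dimF _ free) => i; apply/Fk; split=> //.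
  by rewrite k00 /aff mulmx0 mxE.
have ko : aff k o < 0.
  rewrite aff_extrapolate; have [_ ->] := proj1 (Fk x) Fx.
  by have := mulr_gt0 t_gt0 (aff_barycenter_gt0 k0 kn0); lra.
pose s := - aff h o / aff k o.
have s0 : 0 < s by rewrite /s mulNr -mulrN -invrN mulr_gt0 // invr_gt0 oppr_gt0.
pose f := h + s *: k.
have fo : aff f o = 0 by rewrite affD affZ /s divfK ?lt_eqF // subrr.
have fE i : ev w (usubmx f) i = aff h V`_i + s * aff k V`_i.
  by rewrite ev_from_apex_aff fo subr0 affD affZ.
have sk i : 0 <= s * aff k V`_(i : I) by rewrite mulr_ge0 ?(ltW s0) // k0.
exists p => //; exists (usubmx f); split=> [i||i].
- by rewrite fE addr_ge0 // h0.
- by rewrite fE hp pu; have [_ ->] := proj1 (Fk u) Fu; rewrite mulr0 addr0.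
- rewrite fE => /eqP; rewrite paddr_eq0 ?sk //; last exact: h0.
  by move=> /andP[/eqP/hZ E _]; rewrite /parallel /w E.
Qed.

Lemma apex_pointed : (0 < d)%N -> exists g, forall i, 0 < ev w g i.
Proof.
move=> d0; have [px pxE [h [h0 hx hZ]]] := pvertex_ray Vx.
have hn0 : h != 0.
  apply/eqP => hE.
  have [|f [fn0 fx]] := @exists_annihilator _ _ [:: hom x]; first by rewrite /= addn1.
  have [i /eqP] := exists_aff_neq0 dimP fn0; apply.
  have /hZ /hom_sub_line -> : ev hv h i = 0 by rewrite hE /ev mulmx0 mxE.
  by rewrite pxE /aff fx ?inE // mxE.
exists (usubmx h) => i; rewrite ev_from_apex_aff aff_extrapolate.
have -> : aff h x = 0 by rewrite -pxE.
have := mulr_gt0 t_gt0 (aff_barycenter_gt0 h0 hn0).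
have : 0 <= aff h V`_i by exact: h0.
by lra.
Qed.

End Apex.

(** The cone with apex [o] lives in dimension [d], one less than the cone over [P], so a nonzero
    functional can be made to vanish at [u] and at [d - 2] further points. *)
Lemma link_connected (Y : seq pt) u v : (2 < d)%N -> (size Y < d.-1)%N ->
  pedge P x u -> pedge P x v -> u \notin Y -> v \notin Y ->
  reachable (fun z => lk_vertex P x z /\ z \notin Y) (lk_edge P x) u v.
Proof.
move=> d2 Yd xu xv uY vY; have d1 := ltnW d2.
have [t t0 [tF tV]] := exists_apex.
have [p pu rp] := neighbour_ray t0 tV d1 xu.
have [q qv rq] := neighbour_ray t0 tV d1 xv.
rewrite -pu -qv in uY vY *.
have [g g0] := apex_pointed t0 (ltnW d1).
pose o := apex t.
have [|a [a0 aY]] := @exists_annihilator _ _ [seq y - o | y <- V`_p :: Y].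
  by rewrite size_map /=; lia.
have {}aY y : y \in V`_p :: Y -> aff (lift_apex t a) y = 0.
  move=> yY; rewrite aff_lift_apex aY ?mxE //.
  exact: (map_f (fun y => y - o) yY).
have la0 : lift_apex t a != 0.
  by apply: contraNneq a0 => /(congr1 usubmx); rewrite col_mxKu linear0 => ->.
pose ok (i : I) := V`_i \notin Y.
pose C (a b : I) :=
  reachable (fun z => lk_vertex P x z /\ z \notin Y) (lk_edge P x) V`_a V`_b.
apply: (@connected_off_hyperplane _ _ _ _ _ g0 ok C _ _ _ _ a p q) => //.
- by move=> b b'; apply/reachable_sym/lk_edge_sym.
- by move=> b b' b''; apply: reachable_trans.
- move=> b b' okb _ rb _ /(parallel_apex_eq t0 tF d1 rb) E.
  by rewrite /C E; apply: reachable_refl; split=> //; apply: ray_lk_vertex rb.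
- move=> b b' okb okb' bb'; apply: reachable1 (cone_edge_lk_edge t0 tF d2 bb').
    by split=> //; apply: (ray_lk_vertex t0) => //; case: bb'.
  by split=> //; apply: (ray_lk_vertex t0) => //; case: bb'.
- move=> i; rewrite ev_from_apex; apply: contraNN => iY.
  by apply/eqP; apply: aY; rewrite inE iY orbT.
- by have [i] := exists_aff_neq0 dimP la0; exists i; rewrite ev_from_apex.
- by rewrite ev_from_apex; apply: aY; rewrite inE eqxx.
Qed.

End Link.

(** * Connectivity and separators with [d] vertices *)

Theorem theorem3 (R : realType) (d : nat) (V : seq 'rV[R]_d) :
  (1 <= d)%N -> has_dim (conv V) d ->
  k_connected (pvertex (conv V)) (pedge (conv V)) d /\
  ((3 <= d)%N ->
   forall X : seq 'rV[R]_d, uniq X -> size X = d ->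
     is_separator (pvertex (conv V)) (pedge (conv V)) X ->
     forall x, x \in X ->
       (forall y, y \in X -> y != x -> lk_vertex (conv V) x y) /\
       is_separator (lk_vertex (conv V) x) (lk_edge (conv V) x) (rem x X)).
Proof.
move=> d1 dimP; split.
  split; first exact: exists_pvertices.
  move=> Y _ Yd _ u v Vu Vv; apply/reachable_path/pvertices_connected => //.
  by rewrite Yd prednK.
move=> d3 X Xuniq Xd [XV [u [v [Vu [Vv [uX [vX sep]]]]]]] x xX.
set P := conv V in dimP XV Vu Vv sep *.
have notin_rem z : z \notin rem x X -> z != x -> z \notin X.
  by rewrite mem_rem_uniq // inE => H zx; move: H; rewrite zx.
have separated : ~ reachable (fun z => pvertex P z /\ z \notin X) (pedge P) u v.
  move=> /reachable_path [s [sU [sV sE]]].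
  have [|z zs zX] := sep s; first by split=> //; split=> // z /sV [].
  by have [_] := sV z zs; rewrite zX.
have sz : size (rem x X) = d.-1 by rewrite size_rem // Xd.
have rem_notin z : z \notin X -> z \notin rem x X by apply/contraNN/mem_rem.
(* Only [d - 1] vertices are deleted here, so a path exists; it must pass through [x], the one
   member of [X] left. *)
have [s [sU [sV [sE sv]]]] : exists s,
    is_path (fun z => pvertex P z /\ z \notin rem x X) (pedge P) u v s.
  apply/reachable_path/pvertices_connected; rewrite ?sz ?prednK //; split=> //; exact: rem_notin.
have xs : x \in s.
  have [|z zs zX] := sep s; first by split=> //; split=> // z /sV [].
  have : z == x by apply: contraTT zX; apply: notin_rem; case: (sV z zs).
  move=> /eqP E; rewrite E inE in zs; case/orP: zs => // /eqP E'.
  by rewrite -E' xX in uX.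
(* The path is cut at [x]; its neighbours [u'] and [v'] on the two sides stay connected to [u] and
   [v] outside [X]. *)
case/splitPr: xs sU sV sE sv => s1 s2 sU sV /is_walk_cat [s1E [u'x s2E]].
rewrite last_cat /=; case: s2 sU sV s2E => [|v' s2] sU sV.
  by move=> _ /= E; rewrite -E xX in vX.
move=> /= [xv' s2E] s2v; set u' := last u s1 in u'x.
have xs1 : x \notin u :: s1.
  by move: sU; rewrite -cat_cons cat_uniq => /and3P[_ /hasPn/(_ x) + _]; apply; rewrite inE eqxx.
have xs2 : x \notin v' :: s2.
  by move: sU; rewrite -cat_cons cat_uniq => /and3P[_ _ /= /andP[]].
have s1X z : z \in u :: s1 -> pvertex P z /\ z \notin X.
  move=> zs; have [|Pz zX] := sV z; first by rewrite -cat_cons mem_cat zs.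
  by split=> //; apply: notin_rem => //; apply: contraNneq xs1 => <-.
have s2X z : z \in v' :: s2 -> pvertex P z /\ z \notin X.
  move=> zs; have [|Pz zX] := sV z.
    by rewrite -cat_cons mem_cat [z \in x :: _]in_cons zs !orbT.
  by split=> //; apply: notin_rem => //; apply: contraNneq xs2 => <-.
have [_ u'X] : pvertex P u' /\ u' \notin X by apply: s1X; rewrite mem_last.
have [_ v'X] : pvertex P v' /\ v' \notin X by apply: s2X; rewrite inE eqxx.
have link_separated : ~ reachable (fun z => lk_vertex P x z /\ z \notin X) (lk_edge P x) u' v'.
  move=> u'v'; apply: separated.
  apply: (@reachable_trans _ _ _ _ u'); first by exists s1.
  apply: (@reachable_trans _ _ _ _ v'); last by exists s2.
  by apply: reachable_sub u'v' => [z [/lk_vertex_pvertex]|a b /lk_edge_pedge].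
have Vx := XV x xX.
have xu' := pedge_sym u'x.
have in_link y : y \in X -> y != x -> lk_vertex P x y.
  (* Deleting the other [d - 2] points of [X] keeps [u'] and [v'] connected in the link; if [y] were
     not in the link, that walk would avoid all of [X]. *)
  move=> yX yx; apply: contrapT => ny; apply: link_separated.
  have yrX : y \in rem x X by rewrite mem_rem_uniq // inE yx.
  have := @link_connected _ _ _ dimP x Vx (rem y (rem x X)) u' v' d3.
  rewrite size_rem // sz => H.
  apply: reachable_sub (H _ xu' xv' _ _); last 3 first.
  - by case: (d) d3 => [|[|]].
  - by apply: contraNN u'X => /mem_rem/mem_rem.
  - by apply: contraNN v'X => /mem_rem/mem_rem.
  - move=> z [Lz zY]; split=> //; apply: notin_rem; last exact: lk_vertex_neq Lz.
    apply: contraNN zY => zrX; rewrite mem_rem_uniq ?rem_uniq // inE zrX andbT.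
    by apply/eqP => E; apply: ny; rewrite -E.
  - by [].
split=> //; split=> [z|].
  by rewrite mem_rem_uniq // inE => /andP[zx zX]; apply: in_link.
(* With nothing deleted, the walk serves only to show that [u'] and [v'] are vertices of the
   link. *)
have [s0 [s0V _ s0v]] : reachable (fun z => lk_vertex P x z /\ z \notin [::]) (lk_edge P x) u' v'.
  by apply: link_connected => //; case: (d) d3 => [|[|]].
exists u', v'; split; first by case: (s0V u'); rewrite ?inE ?eqxx.
split; first by case: (s0V v'); rewrite // -s0v mem_last.
do 2 (split; first exact: rem_notin).
move=> q [_ [qV [qE qv]]]; apply: contrapT => noq; apply: link_separated.
exists q; split=> // z zq; have Lz := qV z zq; split=> //.
apply: notin_rem; last exact: lk_vertex_neq Lz.
by apply/negP => zX; apply: noq; exists z.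
Qed.
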